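(* Let $\mathfrak{a}=(z^{\alpha^1},\dots,z^{\alpha^k})\subset\mathbb{C}[z_1,\dots,z_n]$ be a monomial ideal, with multi-indices $\alpha^1,\dots,\alpha^k\in(\mathbb{N}\cup\{0\})^n$, and let $\overline{\mathfrak{a}}^{an}$ be its analytic integral closure. Then: (i) $\overline{\mathfrak{a}}^{an}$ is also a monomial ideal. (ii) For every multi-index $\beta\in(\mathbb{N}\cup\{0\})^n$, $z^{\beta}\in\overline{\mathfrak{a}}^{an}$ if and only if $\beta\in P(\mathfrak{a})$.
   Context: A monomial ideal is an ideal of $\mathbb{C}[z_1,\dots,z_n]$ generated by monomials $z^{\alpha}=z_1^{\alpha_1}\cdots z_n^{\alpha_n}$, $\alpha\in(\mathbb{N}\cup\{0\})^n$; here $k\ge 1$, so $\mathfrak{a}\neq 0$. Newton polyhedron: let $C\subset\mathbb{R}_{\ge 0}^n$ be the convex hull of $\{\alpha^1,\dots,\alpha^k\}$. Then $P(\mathfrak{a})=\bigcup_{\mathbf{x}\in C}(\mathbf{x}+\mathbb{R}_{\ge 0}^n)$. Analytic integral closure: for a non-zero ideal $\mathfrak{a}=(p_1,\dots,p_k)\subset\mathbb{C}[z_1,\dots,z_n]$, a polynomial $f\in\mathbb{C}[z_1,\dots,z_n]$ belongs to $\overline{\mathfrak{a}}^{an}$ if for any $q\in\mathbb{C}^n$ there exist a neighborhood $\mathcal{V}$ of $q$ and a constant $C>0$ such that $|f(z)|\le C\sum_{i=1}^k|p_i(z)|$ for all $z\in\mathcal{V}$. *)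

(* Defs.v *)
From HB Require Import structures.
From mathcomp Require Import all_boot all_order all_algebra.
From mathcomp Require Import complex.
From mathcomp Require Import boolp classical_sets reals topology normedtype.
From mathcomp Require Import convex.
(* The notations of mpoly clash with those of mathcomp-analysis. *)
From mathcomp Require Import -(notations) mpoly.

Set Implicit Arguments.
Unset Strict Implicit.
Unset Printing Implicit Defensive.

Import Order.TTheory GRing.Theory Num.Theory numFieldNormedType.Exports.

Local Open Scope classical_set_scope.
Local Open Scope ring_scope.
Local Open Scope complex_scope.

Section Definitions.
Variable R : realType.
Variable n : nat.

Local Notation Cpoly := (mpoly n R[i]).
Local Notation mon := (multinom n).

(* R[i]^o is R[i] with the topology given by its norm; 'rV[R[i]^o]_n is C^n. *)
Definition eval_at (f : Cpoly) (z : 'rV[R[i]^o]_n) : R[i] :=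
  meval (fun j => z ord0 j) f.

Definition monomial (m : mon) : Cpoly := mpolyX R[i] m.

Definition ideal_gen k (p : 'I_k -> Cpoly) : set Cpoly :=
  [set f | exists h : 'I_k -> Cpoly, f = \sum_(i < k) h i * p i].

(* C[z_1, .., z_n] being Noetherian, finitely many generators lose nothing. *)
Definition monomial_ideal (I : set Cpoly) : Prop :=
  exists k (alpha : 'I_k -> mon),
    (0 < k)%N /\ I = ideal_gen (fun i => monomial (alpha i)).

(* Written on a list of generators; it only depends on the ideal they generate,
   see an_closure_ideal_gen. *)
Definition an_closure k (p : 'I_k -> Cpoly) : set Cpoly :=
  [set f | forall q : 'rV[R[i]^o]_n, exists2 c : R, 0 < c &
    \forall z \near q,
      `|eval_at f z| <= c%:C * \sum_(i < k) `|eval_at (p i) z|].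

Definition mon_point (m : mon) : 'rV[R]_n :=
  \row_(j < n) (fun_of_multinom m j)%:R.

Definition convex_hull (S : set 'rV[R]_n) : set 'rV[R]_n :=
  smallest (@convex_set R 'rV[R]_n) S.

Definition orthant : set 'rV[R]_n := [set v | forall j, 0 <= v ord0 j].

Definition newton_polyhedron k (alpha : 'I_k -> mon) : set 'rV[R]_n :=
  \bigcup_(x in convex_hull (range (fun i => mon_point (alpha i))))
    [set x + v | v in orthant].

End Definitions.

Arguments monomial R {n} m.
Arguments mon_point R {n} m.
Arguments newton_polyhedron R {n k} alpha.

Section Independence.
Variable R : realType.
Variable n : nat.
Local Notation Cpoly := (mpoly n R[i]).

Lemma eval_locally_bounded (f : Cpoly) (q : 'rV[R[i]^o]_n) :
  exists2 c : R, 0 < c & \forall z \near q, `|eval_at f z| <= c%:C.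
Proof.
have real_bound (x : R[i]) : exists2 c : R, 0 < c & `|x| < c%:C.
  have /complex_realP[r xr] := normr_real x.
  have r0 : 0 <= r by rewrite -lecR -xr normr_ge0.
  exists (r + 1); first exact: ltr_wpDl.
  by rewrite xr ltcR ltrDl.
pose P (g : 'rV[R[i]^o]_n -> R[i]) :=
  exists2 c : R, 0 < c & \forall z \near q, `|g z| <= c%:C.
have Pcst x : P (fun=> x).
  by have [c c0 xc] := real_bound x; exists c => //; near=> z; exact: ltW.
have PD g h : P g -> P h -> P (fun z => g z + h z).
  move=> [c c0 gc] [d d0 hd]; exists (c + d); first exact: addr_gt0.
  apply: filterS2 gc hd => z gz hz; rewrite rmorphD /=.
  exact: le_trans (ler_normD _ _) (lerD gz hz).
have PM g h : P g -> P h -> P (fun z => g z * h z).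
  move=> [c c0 gc] [d d0 hd]; exists (c * d); first exact: mulr_gt0.
  apply: filterS2 gc hd => z gz hz; rewrite rmorphM /= normrM.
  by rewrite ler_pM.
have PX (j : 'I_n) : P (fun z => z ord0 j).
  have [c c0 qc] := real_bound (q ord0 j).
  exists c => //.
  have cj : (fun z : 'rV[R[i]^o]_n => z ord0 j) z @[z --> q] --> q ord0 j.
    exact: coord_continuous.
  have cjl : \forall z \near q, `|(z : 'rV[R[i]^o]_n) ord0 j| < c%:C.
    exact: (@cvgr_norm_lt _ R[i]^o _ _ _ _ _ cj c%:C qc).
  by near=> z; apply: ltW; near: z.
have Psum I (s : seq I) (F : I -> 'rV[R[i]^o]_n -> R[i]) :
    (forall m, P (F m)) -> P (fun z => \sum_(m <- s) F m z).
  move=> PF; elim: s => [|m s IH].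
    by under eq_fun do rewrite big_nil; exact: Pcst.
  by under eq_fun do rewrite big_cons; exact: PD.
have Pprod I (s : seq I) (F : I -> 'rV[R[i]^o]_n -> R[i]) :
    (forall m, P (F m)) -> P (fun z => \prod_(m <- s) F m z).
  move=> PF; elim: s => [|m s IH].
    by under eq_fun do rewrite big_nil; exact: Pcst.
  by under eq_fun do rewrite big_cons; exact: PM.
have Pexp g e : P g -> P (fun z => g z ^+ e).
  move=> Pg; elim: e => [|e IH]; first exact: Pcst.
  by under eq_fun do rewrite exprS; exact: PM.
suff : P (eval_at f) by [].
have -> : eval_at f = fun z => \sum_(m <- msupp f)
    mcoeff m f * \prod_j (z ord0 j : R[i]) ^+ m j.
  by apply/funext => z; exact: mevalE.
by apply: Psum => m; apply: PM => //; apply: Pprod => j; exact: Pexp.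
Unshelve. all: by end_near.
Qed.

Lemma ideal_gen_bounded k (p : 'I_k -> Cpoly) f (q : 'rV[R[i]^o]_n) :
  ideal_gen p f -> exists2 c : R, 0 < c &
  \forall z \near q, `|eval_at f z| <= c%:C * \sum_(i < k) `|eval_at (p i) z|.
Proof.
move=> [h ->].
have /(_ _)/cid2 B i := eval_locally_bounded (h i) q.
pose c i := s2val (B i).
have c0 i : 0 < c i by exact: s2valP (B i).
have cP i : \forall z \near q, `|eval_at (h i) z| <= (c i)%:C.
  exact: s2valP' (B i).
exists (1 + \sum_i c i).
  by rewrite ltr_pwDl// sumr_ge0// => i _; exact: ltW.
have : \forall z \near q, forall i, `|eval_at (h i) z| <= (c i)%:C.
  exact: (filter_forall (nbhs_filter q) cP).
apply: filterS => z hz.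
rewrite /eval_at raddf_sum mulr_sumr /=.
apply: le_trans (ler_norm_sum _ _ _) _.
apply: ler_sum => i _; rewrite rmorphM normrM ler_wpM2r//.
apply: le_trans (hz i) _; rewrite lecR (bigD1 i)//= addrCA lerDl addr_ge0//.
by rewrite sumr_ge0// => j _; exact: ltW.
Qed.

Lemma an_closure_sub k l (p : 'I_k -> Cpoly) (r : 'I_l -> Cpoly) :
  (forall i, ideal_gen r (p i)) -> an_closure p `<=` an_closure r.
Proof.
move=> pr f fp q; have [c c0 fc] := fp q.
have /(_ _)/cid2 B i := ideal_gen_bounded q (pr i).
pose d i := s2val (B i).
have d0 i : 0 < d i by exact: s2valP (B i).
have dP i : \forall z \near q,
    `|eval_at (p i) z| <= (d i)%:C * \sum_(j < l) `|eval_at (r j) z|.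
  exact: s2valP' (B i).
have sd0 : 0 <= \sum_i d i by rewrite sumr_ge0// => i _; exact: ltW.
exists (c * (1 + \sum_i d i)); first by rewrite mulr_gt0// ltr_pwDl.
have dPa : \forall z \near q, forall i,
    `|eval_at (p i) z| <= (d i)%:C * \sum_(j < l) `|eval_at (r j) z|.
  exact: (filter_forall (nbhs_filter q) dP).
apply: filterS2 fc dPa => z fz dz.
apply: le_trans fz _; rewrite rmorphM /= -mulrA.
apply: ler_wpM2l; first by rewrite ler0c ltW.
apply: le_trans (ler_sum _ (fun i _ => dz i)) _.
rewrite -mulr_suml; apply: ler_wpM2r; first exact: sumr_ge0.
by rewrite -rmorph_sum lecR lerDr ler01.
Qed.

Lemma an_closure_ideal_gen k l (p : 'I_k -> Cpoly) (r : 'I_l -> Cpoly) :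
  ideal_gen p = ideal_gen r -> an_closure p = an_closure r.
Proof.
have gen m (s : 'I_m -> Cpoly) i : ideal_gen s (s i).
  exists (fun j => (j == i)%:R).
  by rewrite (bigD1 i)//= eqxx mul1r big1 ?addr0// => j /negPf->; rewrite mul0r.
move=> pr; apply/seteqP; split; apply: an_closure_sub => i.
  by rewrite -pr.
by rewrite pr.
Qed.

End Independence.

(* Main.v *)
Require Import Defs.
From mathcomp Require Import all_boot all_order all_algebra.
From mathcomp Require Import complex.
From mathcomp Require Import boolp classical_sets reals topology normedtype.
From mathcomp Require Import interval_inference convex exp.
From mathcomp Require Import zify.
From mathcomp Require Import -(notations) mpoly.

(** Points of P(a) give inequalities between moduli by weighted geometric means;
exponents outside P(a) are detected by the growth of f along monomial curves.

If beta lies in P(a), write beta = x + v with x in the convex hull C of the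
exponents alpha_i and v >= 0.  For a fixed vector r of moduli, r^x is
logarithmically linear in x, so the points x with r^x <= sum_i r^(alpha_i) form
a convex set; it contains every alpha_i, hence all of C
([convex_hull_powR]).  The remaining factor r^v is bounded near each point, and
the required inequality follows ([newton_polyhedron_an_closure]).

Conversely, let f be in the closure and let m be an exponent of f outside
P(a).  By Farkas' lemma some integral weight w >= 0 satisfies
<w, m> < <w, alpha_i> for all i ([newton_polyhedron_or_weight]).  A Kronecker
perturbation turns w into a weight with positive entries that keeps these strict
inequalities and takes distinct values on the exponents of f
([injective_weight]).  Along the curve z_j = t^(w_j), which tends to 0 with t,
|f| is then equivalent to a positive multiple of t^d, d being the least weight of
an exponent of f, while the generators are O(t^(d+1)): the defining inequality at
the origin fails.  So every exponent of f lies in P(a)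
([msupp_an_closure]).  For a monomial f this is the converse implication of the
membership criterion; for a general f it says that the closure, which is an
ideal, is spanned by the monomials with exponent in P(a).

Finitely many of these monomials generate the closure: if N bounds all entries of
the alpha_i, then C lies in [0, N]^n, so replacing each entry of an exponent in
P(a) by its minimum with N leaves it in P(a) ([newton_polyhedron_truncate]). *)

Set Implicit Arguments.
Unset Strict Implicit.
Unset Printing Implicit Defensive.

Import Order.TTheory GRing.Theory Num.Theory numFieldNormedType.Exports.

Local Open Scope classical_set_scope.
Local Open Scope ring_scope.
Local Open Scope complex_scope.

(** * Integral separation from the Newton polyhedron *)

(** Farkas' lemma without division: the multiplier c stands for the common
denominator of the coefficients, so that over the integers both alternatives are
integral.  The induction is on the number of rows. *)
Lemma farkas (K : realDomainType) k m (A : 'M[K]_(k, m)) (b : 'rV[K]_m) :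
  (exists c (l : 'rV[K]_k),
     [/\ 0 < c, forall i, 0 <= l ord0 i & c *: b = l *m A]) \/
  (exists y : 'cV[K]_m,
     (forall i, 0 <= (A *m y) i ord0) /\ (b *m y) ord0 ord0 < 0).
Proof.
elim: k A b => [|k IH] A b.
  have [->|b0] := eqVneq b 0.
    by left; exists 1, 0; rewrite ltr01 scaler0 mul0mx; split=> // -[].
  right; exists (- b^T); split; first by case.
  rewrite mulmxN !mxE oppr_lt0 lt_neqAle eq_sym.
  have sq_ge0 j : true -> 0 <= b ord0 j * b^T j ord0.
    by rewrite mxE -expr2 sqr_ge0.
  rewrite sumr_ge0 // andbT psumr_eq0 //; apply: contraNN b0 => /allP bz.
  apply/eqP/rowP=> j; apply/eqP.
  by have := bz j (mem_index_enum _); rewrite !mxE mulf_eq0 orbb.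
rewrite -[k.+1]/(1 + k)%N in A *; rewrite -[A]vsubmxK.
move: (usubmx A) (dsubmx A) => a A' {A}.
have [[c [l [c0 l0 cb]]]|[x [xA xb]]] := IH A' b.
  left; exists c, (row_mx 0 l); split=> //; last first.
    by rewrite mul_row_col mul0mx add0r.
  by move=> i; rewrite mxE; case: split => j //; rewrite mxE.
(* Now x satisfies the inequalities of A' and b x < 0, so x is the required
   vector unless a x is negative. *)
have [p axE] : exists p, a *m x = (- p)%:M.
  exists (- (a *m x) ord0 ord0).
  by apply/matrixP=> i j; rewrite !ord1 [RHS]mxE opprK mulr1n.
have [p0|p0] := leP p 0.
  right; exists x; split=> // i; rewrite mul_col_mx mxE.
  by case: split => j //; rewrite ord1 axE mxE mulr1n oppr_ge0.
(* Otherwise compose all forms with y |-> p y + (a y) x, which is p times the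
   projection onto the kernel of a along x; the form a becomes 0 and the other k
   rows are covered by the induction hypothesis. *)
have [[c [l [c0 l0 cb]]]|[y [yA yb]]] :=
  IH (p *: A' + A' *m x *m a) (p *: b + b *m x *m a).
  left; exists (c * p), (row_mx (l *m A' *m x - c *: (b *m x)) (p *: l)); split.
  - exact: mulr_gt0.
  - move=> i; rewrite mxE; case: split => j.
      rewrite !ord1 mxE -mulmxA mxE addr_ge0 //.
        by apply: sumr_ge0 => h _; apply: mulr_ge0.
      by rewrite -scalerN mxE mulr_ge0 ?mxE ?oppr_ge0 ?ltW //; move: xb; rewrite mxE.
    by rewrite mxE mulr_ge0 // ltW.
  - rewrite mul_row_col; apply: (addIr (c *: (b *m x *m a))).
    rewrite -scalerA -scalerDr cb mulmxDr mulmxBl -scalemxAr -!scalemxAl !mulmxA.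
    by rewrite addrAC subrK addrC.
right; exists (p *: y + x *m (a *m y)); split.
  move=> i; rewrite mul_col_mx mxE; case: split => j.
    by rewrite !ord1 mulmxDr mulmxA axE mul_scalar_mx -scalemxAr scaleNr subrr mxE.
  by have := yA j; rewrite mulmxDr mulmxDl -scalemxAr -scalemxAl !mulmxA.
by move: yb; rewrite mulmxDr mulmxDl -scalemxAr -scalemxAl !mulmxA.
Qed.

(** The coefficients are not normalized because Farkas' lemma gives them with
an arbitrary positive sum. *)
Lemma convex_set_sum (R : realType) n (S : set 'rV[R]_n) k
    (l : 'I_k -> R) (x : 'I_k -> 'rV[R]_n) :
  @convex_set R 'rV[R]_n S -> (forall i, 0 <= l i) -> (forall i, S (x i)) ->
  0 < \sum_i l i ->
  exists2 y, S y & \sum_i l i *: x i = (\sum_i l i) *: y.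
Proof.
move=> Scvx; elim: k l x => [|k IH] l x l0 Sx; first by rewrite big_ord0 ltxx.
rewrite !big_ord_recr /=; set s := \sum_(i < k) _; set a := l ord_max => sa0.
have a0 : 0 <= a by exact: l0.
have [s0|s0] := leP s 0.
  have sz : s = 0 by apply/le_anti; rewrite s0 sumr_ge0.
  exists (x ord_max) => //; rewrite sz add0r big1 ?add0r // => i _.
  have /eqP := sz; rewrite psumr_eq0 // => /allP /(_ i (mem_index_enum _)) /eqP ->.
  by rewrite scale0r.
have [y Sy ->] := IH _ _ (fun i => l0 (widen_ord (leqnSn k) i))
  (fun i => Sx (widen_ord (leqnSn k) i)) s0.
have p0 : 0 <= s / (s + a) by rewrite divr_ge0 // ltW.
have p1 : s / (s + a) <= 1 by rewrite ler_pdivrMr // mul1r lerDl.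
pose p : {i01 R} := Itv01 p0 p1.
exists (conv p (y : convex_lmodType 'rV[R]_n) (x ord_max)).
  by apply/set_mem/Scvx; exact/mem_set.
rewrite -[conv _ _ _]/(s / (s + a) *: y + (1 - s / (s + a)) *: x ord_max).
rewrite scalerDr !scalerA.
have sE : (s + a) * (s / (s + a)) = s by rewrite mulrC divfK ?lt0r_neq0.
by rewrite mulrBr sE mulr1 addrAC subrr add0r.
Qed.

Definition weight n (w : 'I_n -> nat) (m : multinom n) : nat :=
  (\sum_j w j * m j)%N.

(** Farkas' lemma in homogeneous coordinates: the rows (alpha_i, 1) and (e_j, 0)
generate a cone whose points (c x, c), c > 0, are those with x in P(a).  A vector
(w, s) separating (beta, 1) from this cone has w >= 0, and
<w, beta> < - s <= <w, alpha_i>. *)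
Lemma newton_polyhedron_or_weight (R : realType) n k
    (alpha : 'I_k -> multinom n) (beta : multinom n) :
  newton_polyhedron R alpha (mon_point R beta) \/
  exists w : 'I_n -> nat, forall i, (weight w beta < weight w (alpha i))%N.
Proof.
pose M : 'M[int]_(k, n) := \matrix_(i, j) (alpha i j)%:Z.
pose v : 'rV[int]_n := \row_j (beta j)%:Z.
have [[c [l [c0 l0]]]|[y [yA]]] :=
  farkas (block_mx M (const_mx 1 : 'M_(k, 1)) 1%:M 0) (row_mx v (const_mx 1)).
  rewrite -[l]hsubmxK mul_row_block mulmx1 mulmx0 addr0 scale_row_mx.
  move=> /eq_row_mx[cv c1]; left.
  pose t i : R := (lsubmx l ord0 i)%:~R.
  have t0 i : 0 <= t i by rewrite ler0z mxE.
  have tc : \sum_i t i = c%:~R.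
    have /matrixP/(_ ord0 ord0) := c1; rewrite !mxE. rewrite mulr1 => ->.
    by rewrite rmorph_sum; apply: eq_bigr => i _; rewrite /t !mxE mulr1.
  have c0R : 0 < c%:~R :> R by rewrite ltr0z.
  have hcvx : @convex_set R 'rV[R]_n
      (convex_hull (range (fun i => mon_point R (alpha i)))).
    move=> x y p /set_mem Hx /set_mem Hy; apply/mem_set => S [Scvx aS].
    by apply/set_mem/Scvx; apply/mem_set; [apply: Hx|apply: Hy].
  have [||x Hx] := convex_set_sum (x := fun i => mon_point R (alpha i)) hcvx t0.
  - by move=> i S [_]; apply; exists i.
  - by rewrite tc.
  rewrite tc => sx; exists x => //; exists (mon_point R beta - x); last first.
    by rewrite addrC subrK.
  move=> j; rewrite -(pmulr_rge0 _ c0R) -[X in 0 <= X]/(_ * _).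
  have -> : c%:~R * (mon_point R beta - x) ord0 j = (l ord0 (rshift k j))%:~R.
    have : (c%:~R *: x) ord0 j = \sum_i t i * (alpha i j)%:R.
      by rewrite -sx summxE; apply: eq_bigr => i _; rewrite !mxE.
    have /matrixP/(_ ord0 j) := cv; rewrite !mxE => /(congr1 (intr : int -> R)).
    rewrite rmorphD rmorphM rmorph_sum /= mulrBr => -> ->.
    rewrite addrAC (eq_bigr (fun i => t i * (alpha i j)%:R)).
      by rewrite subrr add0r.
    by move=> i _; rewrite /t !mxE rmorphM.
  by rewrite ler0z.
rewrite -[y]vsubmxK; set w := usubmx y; set s := dsubmx y => yv; right.
have w0 j : 0 <= w j ord0.
  have := yA (rshift k j).
  by rewrite -[y]vsubmxK mul_block_col col_mxEd mul1mx mul0mx addr0.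
exists (fun j => `|w j ord0|%N) => i.
have E (m : multinom n) :
    (weight (fun j => `|w j ord0|%N) m)%:Z =
    \sum_j (m j)%:Z * w j ord0.
  rewrite /weight -[Posz _]natz natr_sum; apply: eq_bigr => j _.
  by rewrite mulnC natrM !natz gez0_abs.
rewrite -ltz_nat !E.
have := yA (lshift n i).
rewrite -[y]vsubmxK mul_block_col col_mxEu -/w -/s !mxE big_ord1 mxE mul1r => yi.
move: yv; rewrite mul_row_col !mxE big_ord1 mxE mul1r => yv.
rewrite -(ltrD2r (s ord0 ord0)).
have -> : \sum_j (beta j)%:Z * w j ord0 = \sum_j v ord0 j * w j ord0.
  by apply: eq_bigr => j _; rewrite [X in _ = X * _]mxE.
have -> : \sum_j (alpha i j)%:Z * w j ord0 = \sum_j M i j * w j ord0.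
  by apply: eq_bigr => j _; rewrite [X in _ = X * _]mxE.
exact: lt_le_trans yv yi.
Qed.

(** * Perturbing a weight *)

Lemma digits_inj N n (a b : 'I_n -> nat) :
  (forall j, a j < N)%N -> (forall j, b j < N)%N ->
  (\sum_(j < n) N ^ j * a j = \sum_(j < n) N ^ j * b j)%N -> a =1 b.
Proof.
elim: n a b => [|n IH] a b aN bN; first by move=> _ [].
rewrite !big_ord_recl !expn0 !mul1n.
have step (c : 'I_n.+1 -> nat) :
    (\sum_(i < n) N ^ bump 0 i * c (lift ord0 i) =
     (\sum_(i < n) N ^ i * c (lift ord0 i)) * N)%N.
  by rewrite big_distrl; apply: eq_bigr => i _; rewrite /bump add1n expnS -mulnA mulnC.
rewrite !step => E.
have N0 : (0 < N)%N by exact: leq_ltn_trans (aN ord0).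
have E0 : a ord0 = b ord0.
  have := congr1 (modn^~ N) E.
  by rewrite /= [(a ord0 + _)%N]addnC [(b ord0 + _)%N]addnC !modnMDl !modn_small.
have Er := IH (a \o lift ord0) (b \o lift ord0) (fun j => aN _) (fun j => bN _).
move=> j; case: (unliftP ord0 j) => [i ->|-> //]; apply: Er => /=.
by apply/eqP; rewrite -(eqn_pmul2r N0); move: E; rewrite E0 => /addnI ->.
Qed.

(** The perturbed weight is K w + u, where u_j = N^j separates the members of s,
N being larger than their entries, and K exceeds the values of u on s: the pair
(<w, m>, <u, m>) can be read off <K w + u, m> by division by K. *)
Lemma injective_weight n (w : 'I_n -> nat) (s : seq (multinom n)) :
  exists w' : 'I_n -> nat,
  [/\ forall j, (0 < w' j)%N,
      {in s &, injective (weight w')} &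
      forall a b, a \in s -> (weight w a < weight w b)%N ->
        (weight w' a < weight w' b)%N].
Proof.
pose N := (\max_(m <- s) mdeg m).+1.
pose u (j : 'I_n) := (N ^ j)%N.
pose K := (\max_(m <- s) weight u m).+1.
have uK m : m \in s -> (weight u m < K)%N by move=> ms; rewrite ltnS leq_bigmax_seq.
have E m : weight (fun j => K * w j + u j)%N m = (K * weight w m + weight u m)%N.
  by rewrite /weight big_distrr -big_split; apply: eq_bigr => j _ /=; lia.
exists (fun j => K * w j + u j)%N; split.
- by move=> j; rewrite addn_gt0 expn_gt0 orbT.
- move=> a b sa sb; rewrite !E => ab; apply/mnmP.
  have mN m : m \in s -> forall j, (m j < N)%N.
    move=> ms j; rewrite ltnS (leq_trans _ (leq_bigmax_seq _ ms _)) //.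
    by rewrite mdegE (bigD1 j) //= leq_addr.
  apply: digits_inj (mN _ sa) (mN _ sb) _; rewrite -/(weight u a) -/(weight u b).
  have := congr1 (modn^~ K) ab.
  by rewrite /= ![(K * _)%N]mulnC !modnMDl !modn_small ?uK.
- move=> a b sa ab; rewrite !E.
  apply: (@leq_trans (K * (weight w a).+1)); last first.
    by rewrite (leq_trans _ (leq_addr _ _)) // leq_pmul2l.
  by rewrite mulnS -addnS [leqRHS]addnC leq_add2l uK.
Qed.

(** * Weighted geometric means over the convex hull *)

(** When s + t = 0 both exponents vanish, so the rule also holds at a = 0, where
a^0 = 1. *)
Lemma ge0_powRD (R : realType) (a s t : R) :
  0 <= s -> 0 <= t -> powR a (s + t) = powR a s * powR a t.
Proof.
move=> s0 t0; have [st|st] := eqVneq (s + t) 0; last first.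
  by apply: powRD; rewrite (negPf st).
move/eqP: st; rewrite paddr_eq0 // => /andP[/eqP-> /eqP->].
by rewrite addr0 powRr0 mulr1.
Qed.

Lemma powR_prod (R : realType) n (F : 'I_n -> R) (p : R) :
  (forall j, 0 <= F j) -> powR (\prod_j F j) p = \prod_j powR (F j) p.
Proof.
move=> F0.
suff [] : 0 <= \prod_j F j /\ powR (\prod_j F j) p = \prod_j powR (F j) p by [].
elim/big_rec2: _ => [|j y z _ [z0 zp]]; first by rewrite ler01 powR1.
by rewrite mulr_ge0 //; split=> //; rewrite powRM // zp.
Qed.

(** The bound does not depend on x, and r^(a y + (1 - a) z) is the weighted
geometric mean of r^y and r^z, so it obeys the bound when both do.  The
nonnegativity of x is proved along with it because this identity relies on it
when an entry of r is 0. *)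
Lemma convex_hull_powR (R : realType) n k (alpha : 'I_k -> multinom n)
    (r : 'I_n -> R) (x : 'rV[R]_n) :
  (forall j, 0 <= r j) ->
  convex_hull (range (fun i => mon_point R (alpha i))) x ->
  (forall j, 0 <= x ord0 j) /\
  \prod_j powR (r j) (x ord0 j) <=
    \sum_i \prod_j r j ^+ alpha i j.
Proof.
move=> r0; set m := \sum_i _.
pose S : set 'rV[R]_n := [set x | (forall j, 0 <= x ord0 j) /\
  \prod_j powR (r j) (x ord0 j) <= m].
have term0 i : 0 <= \prod_j r j ^+ alpha i j.
  by apply: prodr_ge0 => j _; exact: exprn_ge0.
have m0 : 0 <= m by exact: sumr_ge0.
apply: (_ : _ `<=` S); apply: smallest_sub; last first.
  move=> _ [i _ <-]; split=> [j|]; first by rewrite mxE.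
  rewrite (eq_bigr (fun j => r j ^+ alpha i j)).
    by rewrite /m (bigD1 i) //= lerDl sumr_ge0.
  by move=> j _; rewrite mxE powR_mulrn.
move=> y z p /set_mem[y0 ym] /set_mem[z0 zm]; apply/mem_set.
rewrite -[conv _ _ _]/(p%:num *: y + (1 - p%:num) *: z).
have [a0 b0] : 0 <= p%:num :> R /\ 0 <= 1 - p%:num :> R.
  by split; [exact: ge0 | rewrite subr_ge0; exact: le1].
move: (p%:num) a0 b0 => a a0 b0.
have powR_le (u q : R) : 0 <= q -> 0 <= u -> u <= m -> powR u q <= powR m q.
  by move=> *; apply: ge0_ler_powR; rewrite ?nnegrE.
have prod0 (u : 'rV[R]_n) : 0 <= \prod_j powR (r j) (u ord0 j).
  by apply: prodr_ge0 => j _; exact: powR_ge0.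
split=> [j|]; first by rewrite !mxE addr_ge0 // mulr_ge0.
rewrite (eq_bigr (fun j => powR (powR (r j) (y ord0 j)) a *
                           powR (powR (r j) (z ord0 j)) (1 - a))); last first.
  move=> j _; rewrite !mxE ge0_powRD ?mulr_ge0 //.
  by rewrite [a * _]mulrC [(1 - a) * _]mulrC !powRrM.
rewrite big_split /=.
rewrite -(powR_prod (F := fun j => powR (r j) (y ord0 j))); last first.
  by move=> j; exact: powR_ge0.
rewrite -(powR_prod (F := fun j => powR (r j) (z ord0 j))); last first.
  by move=> j; exact: powR_ge0.
have -> : m = powR m a * powR m (1 - a).
  by rewrite -ge0_powRD // addrC subrK powRr1.
by apply: ler_pM; rewrite ?powR_ge0 ?powR_le.
Qed.

(** * Growth along monomial curves *)

Section AnalyticClosure.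
Variables (R : realType) (n : nat).
Local Notation Cpoly := (mpoly n R[i]).
Local Notation modulus := (@ComplexField.Normc.normc R).

Let normE (x : R[i]) : `|x| = (modulus x)%:C. Proof. by []. Qed.

Let modulus_ge0 (x : R[i]) : 0 <= modulus x.
Proof. by rewrite -lecR -normE; exact: normr_ge0. Qed.

Lemma norm_monomial (m : multinom n) (z : 'rV[R[i]^o]_n) :
  `|eval_at (monomial R m) z| = (\prod_j modulus (z ord0 j) ^+ m j)%:C.
Proof.
rewrite /eval_at /monomial mevalX normr_prod rmorph_prod.
by apply: eq_bigr => j _; rewrite normrX normE rmorphXn.
Qed.

Definition monomial_curve (w : 'I_n -> nat) (t : R) : 'rV[R[i]^o]_n :=
  \row_j (t%:C ^+ w j : R[i]^o).

Lemma eval_at_monomial_curve w t (f : Cpoly) :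
  eval_at f (monomial_curve w t) =
  \sum_(m <- msupp f) mcoeff m f * t%:C ^+ weight w m.
Proof.
rewrite /eval_at mevalE; apply: eq_bigr => m _; congr (_ * _).
rewrite /weight -prodrXr; apply: eq_bigr => j _.
by rewrite mxE exprM.
Qed.

Lemma norm_monomial_curve w t (m : multinom n) : 0 <= t ->
  `|eval_at (monomial R m) (monomial_curve w t)| = t%:C ^+ weight w m.
Proof.
move=> t0; rewrite norm_monomial rmorph_prod /weight -prodrXr.
apply: eq_bigr => j _; rewrite rmorphXn /= exprM; congr (_ ^+ _).
by rewrite mxE -normE normrX ger0_norm // ler0c.
Qed.

Lemma near_monomial_curve w (P : 'rV[R[i]^o]_n -> Prop) :
  (forall j, (0 < w j)%N) -> (\forall z \near (0 : 'rV[R[i]^o]_n), P z) ->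
  exists2 e : R, 0 < e &
    forall t, 0 < t -> t < e -> t < 1 -> P (monomial_curve w t).
Proof.
move=> w0 /nbhs_ballP[e /= e0 eP].
have /complex_realP[r er] : e \is Num.real by exact: gtr0_real.
have r0 : 0 < r by rewrite -ltcR -er.
exists r => // t t0 tr t1; apply: eP; split=> // i j; rewrite !mxE.
rewrite -ball_normE /= sub0r normrN normrX ger0_norm ?ler0c ?ltW // er.
rewrite -rmorphXn ltcR; apply: le_lt_trans tr.
by rewrite -[leRHS]expr1 ler_wiXn2l ?ltW // w0.
Qed.

Lemma min_weight (w : 'I_n -> nat) (s : seq (multinom n)) m : m \in s ->
  exists2 m0, m0 \in s & forall m', m' \in s -> (weight w m0 <= weight w m')%N.
Proof.
move=> ms.
have ex : exists v, has (fun m' => weight w m' == v) s.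
  by exists (weight w m); apply/hasP; exists m.
have [v /hasP[m0 m0s /eqP <-] vmin] := ex_minnP ex.
by exists m0 => // m' m's; apply: vmin; apply/hasP; exists m'.
Qed.

(** Otherwise f decays like t^d along a monomial curve on which all the generators
are O(t^(d+1)). *)
Lemma msupp_an_closure k (alpha : 'I_k -> multinom n) (f : Cpoly) m :
  an_closure (fun i => monomial R (alpha i)) f -> m \in msupp f ->
  newton_polyhedron R alpha (mon_point R m).
Proof.
move=> fcl mf.
have [//|[w wm]] := newton_polyhedron_or_weight R alpha m; exfalso.
have [w' [w'0 w'inj w'lt]] := injective_weight w (msupp f).
have [m0 m0f m0min] := min_weight w' mf.
set d := weight w' m0 in m0min.
have dalpha i : (d < weight w' (alpha i))%N.
  exact: leq_ltn_trans (m0min _ mf) (w'lt _ _ mf (wm i)).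
have [c c0 near0] := fcl 0.
have [e e0 curve] := near_monomial_curve w'0 near0.
(* a and B are the constants of the two estimates |f| >= a t^d - S t^(d+1) and
   |f| <= c k t^(d+1); together they give a <= B t. *)
pose S : R := \sum_(m <- msupp f) modulus (mcoeff m f).
have S0 : 0 <= S by exact: sumr_ge0.
pose B := c * k%:R + S.
have B0 : 0 <= B by rewrite addr_ge0 // mulr_ge0 // ltW.
pose a := modulus (mcoeff m0 f).
have a0 : 0 < a by rewrite -ltcR -normE normr_gt0 -mcoeff_msupp.
have bound t : 0 < t -> t < e -> t < 1 -> a <= B * t.
  move=> t0 te t1; have := curve t t0 te t1.
  have T0 : 0 < t%:C :> R[i] by rewrite ltcR.
  have T1 : t%:C <= 1 :> R[i] by rewrite lecR ltW.
  have Tle v : (d < v)%N -> t%:C ^+ v <= t%:C ^+ d.+1 :> R[i].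
    by move=> dv; rewrite ler_wiXn2l // ltW.
  rewrite eval_at_monomial_curve (bigD1_seq m0) ?msupp_uniq //= -/d.
  set x := _ * _; set y := \sum_(_ <- _ | _) _; set z := _ * _ => fle.
  have yle : `|y| <= S%:C * t%:C ^+ d.+1.
    apply: le_trans (ler_norm_sum _ _ _) _.
    rewrite /S (bigD1_seq m0) ?msupp_uniq //= rmorphD mulrDl.
    apply: ler_wpDl; first by rewrite mulr_ge0 ?exprn_ge0 ?ler0c ?ltW.
    rewrite rmorph_sum mulr_suml big_seq_cond [leRHS]big_seq_cond.
    apply: ler_sum => m' /andP[m'f m'0].
    rewrite normrM normrX (ger0_norm (ltW T0)) normE.
    apply: ler_wpM2l; first by rewrite ler0c.
    apply: Tle; rewrite ltn_neqAle m0min // andbT.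
    apply: contra m'0 => /eqP dE; apply/eqP; apply: w'inj => //.
  have zle : z <= (c * k%:R)%:C * t%:C ^+ d.+1.
    rewrite /z rmorphM -mulrA ler_pM2l ?ltcR // rmorph_nat.
    have -> : k%:R * t%:C ^+ d.+1 = \sum_(i < k) t%:C ^+ d.+1 :> R[i].
      by rewrite sumr_const card_ord mulr_natl.
    by apply: ler_sum => i _; rewrite norm_monomial_curve; [exact: Tle|exact: ltW].
  have xle : `|x| <= (B * t)%:C * t%:C ^+ d.
    rewrite [in leRHS]rmorphM -mulrA -exprS rmorphD mulrDl.
    apply: le_trans (lerD (le_trans fle zle) yle).
    by rewrite -[x in leLHS](addrK y) ler_normB.
  rewrite -lecR -(ler_pM2r (exprn_gt0 d T0)); apply: le_trans xle.
  by rewrite normrM normrX (ger0_norm (ltW T0)).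
(* B may be 0, hence the denominator B + 1. *)
pose q := a / (B + 1).
have q0 : 0 < q by rewrite divr_gt0 // ltr_wpDl.
pose t := Num.min q (Num.min e 1) / 2.
have tm : t < Num.min q (Num.min e 1).
  by rewrite ltr_pdivrMr // ltr_pMr ?ltr1n // !lt_min q0 e0 ltr01.
have t0 : 0 < t by rewrite divr_gt0 // !lt_min q0 e0 ltr01.
move: tm; rewrite !lt_min => /and3P[tq te t1].
have := bound t t0 te t1; rewrite leNgt => /negP; apply.
apply: le_lt_trans (_ : (B + 1) * t < a); first by rewrite ler_wpM2r ?lerDl ?ltW.
by rewrite mulrC -ltr_pdivlMr // ltr_wpDl.
Qed.

(** With beta = x + v, the factor |z|^x is controlled by [convex_hull_powR], and
|z|^v by a bound on the coordinates near q. *)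
Lemma newton_polyhedron_an_closure k (alpha : 'I_k -> multinom n) beta :
  newton_polyhedron R alpha (mon_point R beta) ->
  an_closure (fun i => monomial R (alpha i)) (monomial R beta).
Proof.
move=> [x Hx [v v0 xv]] q.
have /(_ _)/cid2 B j := eval_locally_bounded (mpolyX R[i] (mnm1 j)) q.
pose M j := s2val (B j).
have M0 j : 0 < M j by exact: s2valP (B j).
have MP j : \forall z \near q, `|eval_at (mpolyX R[i] (mnm1 j)) z| <= (M j)%:C.
  exact: s2valP' (B j).
exists (\prod_j powR (M j) (v ord0 j)).
  by apply: prodr_gt0 => j _; exact: powR_gt0.
have := filter_forall (nbhs_filter q) MP; apply: filterS => z zM.
rewrite norm_monomial (eq_bigr _ (fun i _ => norm_monomial (alpha i) z)).
rewrite -rmorph_sum -rmorphM lecR.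
pose r j := modulus (z ord0 j).
have r0 j : 0 <= r j by exact: modulus_ge0.
have rM j : r j <= M j.
  by have := zM j; rewrite /eval_at mevalXU normE lecR.
have [x0 xle] := convex_hull_powR r0 Hx.
rewrite (eq_bigr (fun j => powR (r j) (v ord0 j) * powR (r j) (x ord0 j))).
  rewrite big_split /=; apply: ler_pM => //.
  - by apply: prodr_ge0 => j _; exact: powR_ge0.
  - by apply: prodr_ge0 => j _; exact: powR_ge0.
  - apply: ler_prod => j _; rewrite powR_ge0 /=.
    by apply: ge0_ler_powR; rewrite ?nnegrE ?r0 ?v0 ?rM // ltW.
move=> j _; rewrite -ge0_powRD ?v0 ?x0 // -powR_mulrn //; congr (powR _ _).
by move/rowP/(_ j): xv; rewrite !mxE addrC => ->.
Qed.

(** Local inequalities compose, the neighbourhoods being intersected and the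
constants multiplied; this makes the closure an ideal. *)
Lemma an_closure_trans k l (p : 'I_k -> Cpoly) (r : 'I_l -> Cpoly) :
  (forall i, an_closure r (p i)) -> an_closure p `<=` an_closure r.
Proof.
move=> pr f fp q; have [c c0 fc] := fp q.
have /(_ _)/cid2 B i := pr i q.
pose d i := s2val (B i).
have d0 i : 0 < d i by exact: s2valP (B i).
have dP i : \forall z \near q,
    `|eval_at (p i) z| <= (d i)%:C * \sum_(j < l) `|eval_at (r j) z|.
  exact: s2valP' (B i).
have sd0 : 0 <= \sum_i d i by rewrite sumr_ge0 // => i _; exact: ltW.
exists (c * (1 + \sum_i d i)); first by rewrite mulr_gt0 // ltr_pwDl.
apply: filterS2 fc (filter_forall (nbhs_filter q) dP) => z fz dz.
apply: le_trans fz _; rewrite rmorphM /= -mulrA.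
apply: ler_wpM2l; first by rewrite ler0c ltW.
apply: le_trans (ler_sum _ (fun i _ => dz i)) _.
rewrite -mulr_suml; apply: ler_wpM2r; first exact: sumr_ge0.
by rewrite -rmorph_sum lecR lerDr ler01.
Qed.

Lemma ideal_gen_sub_an_closure k l (p : 'I_k -> Cpoly) (r : 'I_l -> Cpoly) :
  (forall i, an_closure r (p i)) -> ideal_gen p `<=` an_closure r.
Proof.
by move=> pr f fp; apply: (an_closure_trans pr) => q; exact: ideal_gen_bounded.
Qed.


End AnalyticClosure.

(** * Finitely many generators *)

Lemma ideal_gen_mull (R : realType) n k (p : 'I_k -> mpoly n R[i]) g i :
  ideal_gen p (g * p i).
Proof.
exists (fun j => if j == i then g else 0).
by rewrite (bigD1 i) //= eqxx big1 ?addr0 // => j /negPf->; rewrite mul0r.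
Qed.

Lemma ideal_gen_sum (R : realType) n k (p : 'I_k -> mpoly n R[i])
    (I : eqType) (s : seq I) (F : I -> mpoly n R[i]) :
  (forall m, m \in s -> ideal_gen p (F m)) -> ideal_gen p (\sum_(m <- s) F m).
Proof.
move=> pF; rewrite big_seq; apply: (big_ind (ideal_gen p)) => //.
  by exists (fun=> 0); rewrite big1 // => i _; rewrite mul0r.
move=> _ _ [h ->] [h' ->]; exists (fun i => h i + h' i).
by rewrite -big_split; apply: eq_bigr => i _; rewrite mulrDl.
Qed.

Lemma mon_point_newton_polyhedron (R : realType) n k
    (alpha : 'I_k -> multinom n) i :
  newton_polyhedron R alpha (mon_point R (alpha i)).
Proof.
exists (mon_point R (alpha i)); first by move=> S [_]; apply; exists i.
by exists 0; [move=> j; rewrite mxE | rewrite addr0].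
Qed.

Definition truncate n N (m : multinom n) : multinom n :=
  Multinom [tuple minn (m j) N | j < n].

Lemma truncateE n N (m : multinom n) j :
  truncate N m j = minn (m j) N.
Proof. exact: mnmE. Qed.

(** The convex hull of the alpha_i lies in the box of side N, so a hull point
below beta is also below its truncation. *)
Lemma newton_polyhedron_truncate (R : realType) n k
    (alpha : 'I_k -> multinom n) N (beta : multinom n) :
  (forall i j, (alpha i j <= N)%N) ->
  newton_polyhedron R alpha (mon_point R beta) ->
  newton_polyhedron R alpha (mon_point R (truncate N beta)).
Proof.
move=> alphaN [x Hx [v v0 xv]]; exists x => //.
pose S : set 'rV[R]_n := [set x | forall j, x ord0 j <= N%:R].
have xN : S x.
  move: x Hx {xv}; apply: smallest_sub; last first.
    by move=> _ [i _ <-] j; rewrite mxE ler_nat.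
  move=> y z p /set_mem Sy /set_mem Sz; apply/mem_set => j.
  rewrite -[conv _ _ _]/(p%:num *: y + (1 - p%:num) *: z) !mxE.
  have -> : N%:R = p%:num * N%:R + (1 - p%:num) * N%:R :> R.
    by rewrite -mulrDl addrC subrK mul1r.
  by apply: lerD; apply: ler_wpM2l; rewrite ?subr_ge0 ?Sy ?Sz //; exact: le1.
exists (mon_point R (truncate N beta) - x); last by rewrite addrC subrK.
move=> j; rewrite !mxE truncateE subr_ge0.
have [_|_] := leqP (beta j) N; last exact: xN.
by move/rowP/(_ j): xv; rewrite !mxE => <-; rewrite lerDl.
Qed.

Theorem theorem4p5 (R : realType) (n k : nat) (hk : (0 < k)%N)
    (alpha : 'I_k -> multinom n) :
  monomial_ideal (an_closure (fun i => monomial R (alpha i))) /\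
  (forall beta : multinom n,
     an_closure (fun i => monomial R (alpha i)) (monomial R beta) <->
     newton_polyhedron R alpha (mon_point R beta)).
Proof.
split; last first.
  move=> beta; split; last exact: newton_polyhedron_an_closure.
  by move=> /msupp_an_closure; apply; rewrite msuppX mem_seq1.
pose N := (\max_i \max_j alpha i j)%N.
have alphaN i j : (alpha i j <= N)%N.
  exact: leq_trans (leq_bigmax j) (leq_bigmax (F := fun i => \max_j alpha i j) i).
(* The truncated exponents have total degree at most n N; those of degree less
   than b form a finite type, which enumerates the generators. *)
pose b := (n * N).+1.
have truncate_lt (m : multinom n) : (mdeg (truncate N m) < b)%N.
  have -> : b = (\sum_(j < n) N)%N.+1 by rewrite sum_nat_const card_ord.
  rewrite ltnS mdegE.
    by apply: leq_sum => j _; rewrite truncateE geq_minr.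
pose A := [pred m : bmultinom n b |
  `[< newton_polyhedron R alpha (mon_point R (bmnm m)) >]].
have truncA m : newton_polyhedron R alpha (mon_point R m) ->
    BMultinom (truncate_lt m) \in A.
  by move=> mP; apply/asboolP; exact: newton_polyhedron_truncate.
have card_gt0 : (0 < #|A|)%N.
  apply/card_gt0P; exists (BMultinom (truncate_lt (alpha (Ordinal hk)))).
  exact/truncA/mon_point_newton_polyhedron.
exists #|A|, (fun i => bmnm (enum_val i)); split=> //.
apply/seteqP; split=> [f fcl|]; last first.
  apply: ideal_gen_sub_an_closure => i; apply: newton_polyhedron_an_closure.
  by apply/asboolP; exact: (enum_valP i).
rewrite [f]mpolyE; apply: ideal_gen_sum => m mf.
have mA := truncA m (msupp_an_closure fcl mf).
set t := truncate N m.
have tm : mnm_add (mnm_sub m t) t = m.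
  by apply/submK/mnm_lepP => j; rewrite truncateE geq_minl.
rewrite -[X in mpolyX _ X]tm mpolyXD scalerAl.
have -> : mpolyX R[i] t = monomial R (bmnm (enum_val
    (enum_rank_in mA (BMultinom (truncate_lt m))))).
  by rewrite enum_rankK_in.
exact: ideal_gen_mull.
Qed.
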